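(* Suppose that the topology of a locally convex space $X$ over $\mathbb{K}$ ($\mathbb{K}=\mathbb{R}$ or $\mathbb{C}$) is induced by a directed family $(\|\cdot\|_\alpha)_{\alpha\in I}$ of complete seminorms. (a) If $T\in GL(X)$ is generalized hyperbolic and $T(\mathrm{Ker}(\|\cdot\|_\alpha))=\mathrm{Ker}(\|\cdot\|_\alpha)$ for all $\alpha\in I$, then $T$ has the shadowing property. (b) If $T\in L(X)$ is generalized hyperbolic and $T(\mathrm{Ker}(\|\cdot\|_\alpha))\subset\mathrm{Ker}(\|\cdot\|_\alpha)$ for all $\alpha\in I$, then $T$ has the positive shadowing property.
   Context: All topological vector spaces are Hausdorff. $\mathbb{N}_0=\{0,1,2,\dots\}$. $L(X)$ is the set of continuous linear operators on $X$; $GL(X)$ is the set of those having a continuous inverse. $X$ is the topological direct sum of subspaces $M,N$ if it is their algebraic direct sum and $(y,z)\mapsto y+z$ is a homeomorphism $M\times N\to X$. A family of seminorms $(\|\cdot\|_\alpha)_{\alpha\in I}$ is directed if for all $\alpha,\beta\in I$ there is $\gamma\in I$ with $\|\cdot\|_\alpha\le\|\cdot\|_\gamma$ and $\|\cdot\|_\beta\le\|\cdot\|_\gamma$. For a seminorm $\|\cdot\|$ on $X$, $\mathrm{Ker}(\|\cdot\|):=\{x\in X:\|x\|=0\}$. The seminorm $\|\cdot\|$ is complete if every sequence $(x_n)_{n\in\mathbb{N}}$ in $X$ with $\|x_n-x_m\|\to0$ as $n,m\to\infty$ admits some $x\in X$ with $\|x_n-x\|\to0$. Generalized hyperbolic: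 $T\in L(X)$ is generalized hyperbolic if there is a topological direct sum decomposition $X=M\oplus N$ such that: (GH1) $T(M)\subset M$; (GH2) $T(N)\supset N$ and $T|_N:N\to T(N)$ is an isomorphism (linear homeomorphism); (GH3) for every $\alpha\in I$ there exist $\beta\in I$, $c>0$, $t\in(0,1)$ such that $\|T^ny\|_\alpha\le c\,t^n\|y\|_\beta$ and $\|S^nz\|_\alpha\le c\,t^n\|z\|_\beta$ for all $y\in M$, $z\in N$, $n\in\mathbb{N}_0$, where $S:=(T|_N)^{-1}|_N\in L(N)$. (The notion does not depend on the directed family inducing the topology.) $T$ has the positive shadowing property if for every neighborhood $V$ of $0$ there is a neighborhood $U$ of $0$ such that for every sequence $(x_j)_{j\in\mathbb{N}_0}$ in $X$ with $Tx_j-x_{j+1}\in U$ for all $j\in\mathbb{N}_0$ there is $x\in X$ with $x_j-T^jx\in V$ for all $j\in\mathbb{N}_0$. For $T\in GL(X)$, the shadowing property is defined by replacing $\mathbb{N}_0$ by $\mathbb{Z}$. *)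

(* Defs.v *)
From HB Require Import structures.
From mathcomp Require Import all_boot all_order all_algebra.
From mathcomp Require Import complex.
From mathcomp Require Import all_classical all_reals all_analysis.

Set Implicit Arguments.
Unset Strict Implicit.
Unset Printing Implicit Defensive.

Import Order.TTheory GRing.Theory Num.Theory.
Import numFieldNormedType.Exports.

Local Open Scope classical_set_scope.
Local Open Scope ring_scope.
Local Open Scope complex_scope.

(* The equalities are between numFieldType structures, so the order and the
   modulus of K are identified with the usual ones too. *)
Definition real_or_complex (R : realType) (K : numFieldType) : Prop :=
  K = R :> numFieldType \/ K = R[i] :> numFieldType.

(* As for the norm of a [normedModType K], seminorms take values in the scalar
   field: a nonnegative element of R[i] is a nonnegative real number, so over
   R[i] the order on the values is the usual order on the reals. *)
Record is_seminorm (K : numFieldType) (X : lmodType K) (p : X -> K) : Prop := {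
  seminorm_ge0 : forall x, 0 <= p x;
  seminormD : forall x y, p (x + y) <= p x + p y;
  seminormZ : forall (a : K) x, p (a *: x) = `|a| * p x }.

Definition seminorm_ker (K : numFieldType) (X : lmodType K) (p : X -> K) :
  set X := [set x | p x = 0].

Definition complete_seminorm (K : numFieldType) (X : lmodType K)
    (p : X -> K) : Prop :=
  forall u : nat -> X,
    p (u nm.1 - u nm.2) @[nm --> (\oo, \oo)] --> 0 ->
    exists x : X, p (u n - x) @[n --> \oo] --> 0.

Definition directed_seminorms (K : numFieldType) (X : lmodType K) (I : Type)
    (p : I -> X -> K) : Prop :=
  forall a b, exists c, forall x, p a x <= p c x /\ p b x <= p c x.

Definition induced_by_seminorms (K : numFieldType) (X : tvsType K) (I : Type)
    (p : I -> X -> K) : Prop :=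
  forall (x : X) (U : set X),
    nbhs x U <->
    exists F : set I, finite_set F /\
      exists2 e : K, 0 < e & [set y | forall i, F i -> p i (y - x) < e] `<=` U.

Definition GL (K : numFieldType) (X : tvsType K) (T : {linear X -> X}) : Prop :=
  continuous T /\
  exists S : X -> X, [/\ continuous S, cancel T S & cancel S T].

(* The inverse of T restricted to A, as a map from T @` A onto A when T is
   injective on A; its value outside T @` A is irrelevant. *)
Definition inv_on (K : numFieldType) (X : tvsType K) (A : set X) (T : X -> X) :
  X -> X := 'pinv_(fun=> 0) A T.

Definition iterz (K : numFieldType) (X : tvsType K) (T : X -> X) (j : int) :
    X -> X :=
  match j with
  | Posz n => iter n T
  | Negz n => iter n.+1 (inv_on setT T)
  end.

(* Both the algebraic direct sum and the homeomorphism condition are carried by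
   the sum map on M * N, where M and N have the subspace topology. *)
Definition topological_direct_sum (K : numFieldType) (X : tvsType K)
    (M N : set X) : Prop :=
  [/\ submod_closed [in M], submod_closed [in N] &
      let add (yz : M * N) : X := \val yz.1 + \val yz.2 in
      continuous add /\
      exists g : X -> M * N, [/\ continuous g, cancel add g & cancel g add]].

Definition generalized_hyperbolic (K : numFieldType) (X : tvsType K) (I : Type)
    (p : I -> X -> K) (T : {linear X -> X}) : Prop :=
  exists M N : set X,
    [/\ topological_direct_sum M N,
        T @` M `<=` M,
        [/\ N `<=` T @` N, {in N &, injective T}, {within N, continuous T} &
            {within T @` N, continuous (inv_on N T)}] &
        forall a, exists b, exists c t : K,
          [/\ 0 < c, 0 < t < 1,
              forall y n, M y -> p a (iter n T y) <= c * t ^+ n * p b y &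
              forall z n, N z ->
                p a (iter n (inv_on N T) z) <= c * t ^+ n * p b z]].

Definition positive_shadowing (K : numFieldType) (X : tvsType K)
    (T : X -> X) : Prop :=
  forall V : set X, nbhs 0 V ->
    exists2 U : set X, nbhs 0 U &
      forall x : nat -> X, (forall j, U (T (x j) - x j.+1)) ->
        exists y : X, forall j, V (x j - iter j T y).

Definition shadowing (K : numFieldType) (X : tvsType K) (T : X -> X) : Prop :=
  forall V : set X, nbhs 0 V ->
    exists2 U : set X, nbhs 0 U &
      forall x : int -> X, (forall j, U (T (x j) - x (j + 1))) ->
        exists y : X, forall j, V (x j - iterz T j y).

(* Main.v *)
(* Fix a seminorm p of the family. A pseudo-orbit x with small errors is
   corrected to w = x + d, where d is the p-limit of the usual series built from
   the forward iterates of the M-parts and the backward iterates of the N-parts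
   of the errors. Because limits exist only for one seminorm at a time, w is an
   orbit only modulo ker p; the invariance of ker p turns this into
   w_j - T^j w_0 in ker p, so w_0 shadows x. Taking the limit inside T needs T to
   be continuous for p alone: this is the open mapping theorem for the Banach
   spaces X / ker q -> X / ker p, q >= p.

   Seminorms take values in K = R or R[i], and the arguments below only use that
   K is an Archimedean numFieldType. *)

Require Import Defs.
From HB Require Import structures.
From mathcomp Require Import all_boot all_order all_algebra.
From mathcomp Require Import complex.
From mathcomp Require Import all_classical all_reals all_analysis.

Set Implicit Arguments.
Unset Strict Implicit.
Unset Printing Implicit Defensive.

Import Order.TTheory GRing.Theory Num.Theory.
Import numFieldNormedType.Exports.

Local Open Scope classical_set_scope.
Local Open Scope ring_scope.

(** * Archimedean scalars and dependent choice *)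

Lemma real_or_complex_archimedean (R : realType) (K : numFieldType) :
  real_or_complex R K -> Num.archimedean_axiom K.
Proof.
case=> ->; first by move=> x; exists (Num.bound `|x|); exact: archi_boundP.
move=> z; exists (Num.bound (complex.Re `|z|)).
have -> : `|z| = (complex.Re `|z|)%:C%C by rewrite RRe_real ?normr_real.
rewrite -(rmorph_nat (real_complex R)) ltcR.
by rewrite archi_boundP // -ler0c RRe_real ?normr_real.
Qed.

Section Archimedean.
Variables (K : numFieldType) (archK : Num.archimedean_axiom K).

Lemma bernoulli_ineq (h : K) n : 0 <= h -> 1 + h *+ n <= (1 + h) ^+ n.
Proof.
move=> h0; elim: n => [|n IHn]; first by rewrite mulr0n addr0 expr0.
rewrite exprS; apply: le_trans (_ : (1 + h) * (1 + h *+ n) <= _); last first.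
  by rewrite ler_wpM2l // addr_ge0.
rewrite mulrDl mul1r mulrDr mulr1 mulrSr !addrA lerDl.
by rewrite mulr_ge0 // mulrn_wge0.
Qed.

Lemma exprn_lt_eps (t e : K) : 0 < t < 1 -> 0 < e -> exists n, t ^+ n < e.
Proof.
move=> /andP[t0 t1] e0; pose h := t^-1 - 1.
have h0 : 0 < h by rewrite subr_gt0 invf_gt1.
have [n hn] := archK (e^-1 / h); exists n.
rewrite -[t ^+ n]invrK -exprVn invf_plt ?posrE ?exprn_gt0 ?invr_gt0 //.
apply: lt_le_trans (_ : 1 + h *+ n <= _); last first.
  by rewrite -[in leRHS](subrKC 1 t^-1) bernoulli_ineq // ltW.
rewrite ger0_norm ?divr_ge0 ?invr_ge0 ?ltW // in hn.
rewrite ltr_pdivrMr // mulr_natl in hn.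
by rewrite (lt_le_trans hn) // lerDr.
Qed.

(** Replaces a minimum: the order of [K] may be partial, but positive elements are real, hence
    comparable. *)
Lemma pos_lower_bound (a b : K) : 0 < a -> 0 < b ->
  exists e, [/\ 0 < e, e <= a & e <= b].
Proof.
move=> a0 b0.
have [ab|ba] := real_leP (gtr0_real a0) (gtr0_real b0); first by exists a.
by exists b; split => //; exact: ltW.
Qed.

End Archimedean.

Lemma dependent_choice_nat (T : Type) (P : nat -> T -> Prop)
    (Q : nat -> T -> T -> Prop) (x0 : T) :
  P 0 x0 -> (forall k x, P k x -> exists y, P k.+1 y /\ Q k x y) ->
  exists u : nat -> T,
    u 0 = x0 /\ forall k, P k (u k) /\ Q k (u k) (u k.+1).
Proof.
move=> Px0 step.
have /choice[f fP] : forall kx : nat * T, exists y,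
    P kx.1 kx.2 -> P kx.1.+1 y /\ Q kx.1 kx.2 y.
  move=> [k x] /=; have [/step[y]|nP] := pselect (P k x); first by exists y.
  by exists x0 => /nP.
pose u := fix u k := if k is k'.+1 then f (k', u k') else x0.
have uP k : P k (u k) by elim: k => // k /(fP (k, _))[].
by exists u; split => // k; split => //; have [] := fP (k, u k) (uP k).
Qed.

(** * Seminorms and completeness *)

Section Seminorm.
Variables (K : numFieldType) (X : lmodType K) (p : X -> K).
Hypothesis sp : is_seminorm p.

Lemma seminorm0 : p 0 = 0.
Proof. by rewrite -(scale0r 0) seminormZ // normr0 mul0r. Qed.

Lemma seminormN x : p (- x) = p x.
Proof. by rewrite -scaleN1r seminormZ // normrN1 mul1r. Qed.

Lemma seminormBC x y : p (x - y) = p (y - x).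
Proof. by rewrite -seminormN opprB. Qed.

Lemma seminormB x y : p (x - y) <= p x + p y.
Proof. by rewrite -(seminormN y) seminormD. Qed.

Lemma seminorm_triangle y x z : p (x - z) <= p (x - y) + p (y - z).
Proof. by rewrite -[in leLHS](subrKA y) seminormD. Qed.

Lemma seminorm_eq0 x : (forall e, 0 < e -> p x < e) -> p x = 0.
Proof.
move=> small; apply/eqP; rewrite eq_le seminorm_ge0 // andbT.
rewrite real_leNgt ?real0 ?ger0_real ?seminorm_ge0 //.
by apply/negP => /small; rewrite ltxx.
Qed.

Lemma seminorm_kerD x y : p x = 0 -> p y = 0 -> p (x + y) = 0.
Proof.
move=> x0 y0; apply/eqP; rewrite eq_le seminorm_ge0 // andbT.
by rewrite (le_trans (seminormD sp _ _)) // x0 y0 addr0.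
Qed.

Lemma seminorm_ker_le x y : p (x - y) = 0 -> p x <= p y.
Proof.
move=> xy; rewrite -[x in leLHS](subrK y).
by rewrite (le_trans (seminormD sp _ _)) // xy add0r.
Qed.

(* Completeness in telescoped form: the steps are dominated by the decrements
   of a null sequence r, which then bounds the distance to the limit. *)
Lemma complete_telescope (u : nat -> X) (r : nat -> K) : complete_seminorm p ->
  (forall k, 0 <= r k) -> (forall e, 0 < e -> exists k, r k < e) ->
  (forall k, p (u k - u k.+1) <= r k - r k.+1) ->
  exists x, forall k, p (u k - x) <= r k.
Proof.
move=> cp r0 rlim ur.
have tele m k : p (u m - u (m + k)%N) <= r m - r (m + k)%N.
  elim: k => [|k IHk]; first by rewrite addn0 !subrr seminorm0.
  rewrite addnS (le_trans (seminorm_triangle (u (m + k)%N) _ _)) //.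
  by rewrite -(subrKA (r (m + k)%N) (r m)) lerD.
have rle m n : (m <= n)%N -> p (u m - u n) <= r m.
  by move=> /subnKC <-; rewrite (le_trans (tele _ _)) // gerBl.
have rdec m n : (m <= n)%N -> r n <= r m.
  move=> /subnKC <-; rewrite -subr_ge0.
  exact: le_trans (seminorm_ge0 sp _) (tele _ _).
have [|x ux] := cp u.
  apply/cvgr0Pnorm_lt => e e0; have [N rN] := rlim e e0.
  exists ([set n | (N <= n)%N], [set n | (N <= n)%N]) => /=.
    by split; exists N.
  move=> [m n] /= [Nm Nn]; rewrite ger0_norm ?seminorm_ge0 //.
  have [mn|/ltnW nm] := leqP m n.
    by rewrite (le_lt_trans (rle _ _ mn)) // (le_lt_trans (rdec _ _ Nm)).
  rewrite seminormBC.
  by rewrite (le_lt_trans (rle _ _ nm)) // (le_lt_trans (rdec _ _ Nn)).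
exists x => k.
have pr : p (u k - x) \is Num.real by rewrite ger0_real ?seminorm_ge0.
(* If the bound failed, a later term closer to [x] than the excess [p (u k - x) - r k] would
   contradict [rle]. *)
rewrite real_leNgt // ?ger0_real //; apply/negP => lt.
move/cvgr0Pnorm_lt : ux => /(_ (p (u k - x) - r k)).
rewrite subr_gt0 => /(_ lt)[N _ Nu].
have := Nu (maxn N k) (leq_maxl _ _).
rewrite /= ger0_norm ?seminorm_ge0 // => small.
have := le_lt_trans (seminorm_triangle (u (maxn N k)) _ _)
  (ler_ltD (rle _ _ (leq_maxr N k)) small).
by rewrite subrKC ltxx.
Qed.

End Seminorm.

(** * The open mapping theorem for two seminorms *)

Section OpenMapping.
Variables (K : numFieldType) (archK : Num.archimedean_axiom K).
Variables (X : lmodType K) (p q : X -> K).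
Hypotheses (sp : is_seminorm p) (sq : is_seminorm q).
Hypotheses (cp : complete_seminorm p) (cq : complete_seminorm q).
Hypothesis pq : forall x, p x <= q x.

Let half : K := 2^-1.

Let half01 : 0 < half < 1.
Proof. by rewrite invr_gt0 ltr0n invf_lt1 ?ltr0n ?ltr1n. Qed.

Let halfD x : x * half + x * half = x.
Proof. by rewrite -splitr. Qed.

(* Baire category: the q-balls of integer radius cover X, so one of them is
   p-dense in some p-ball. *)
Let dense_somewhere : exists (n : nat) x0 r, 0 < r /\
  forall x, p (x - x0) < r -> forall e, 0 < e ->
  exists a, q a <= n%:R /\ p (x - a) < e.
Proof.
apply: contrapT => nowhere.
have far n x0 r : 0 < r -> exists x e,
    [/\ p (x - x0) < r, 0 < e & forall a, q a <= n%:R -> ~ p (x - a) < e].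
  move=> r0; apply: contrapT => near0; apply: nowhere; exists n, x0, r.
  split=> // x xr e e0; apply: contrapT => noa; apply: near0; exists x, e.
  by split=> // a qa pa; apply: noa; exists a.
(* A state is a centre with a radius. [Q] nests the balls, in the form that [complete_telescope]
   takes, and keeps the new closed ball away from the q-ball of radius [k]. *)
pose P k (s : X * K) := 0 < s.2 /\ s.2 <= half ^+ k.
pose Q k (s s' : X * K) := p (s.1 - s'.1) <= s.2 - s'.2 /\
  forall a, q a <= k%:R -> ~ p (s'.1 - a) <= s'.2.
have [half0 half1] := andP half01.
have [||u [_ uP]] := @dependent_choice_nat _ P Q (0, 1).
- by rewrite /P /= expr0.
- move=> k [x r] [/= r0 rk].
  (* Half of [r] is for moving the centre, half for the new radius; a radius of at most [e / 2] fits
     a closed ball into the open one. *)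
  have rh : 0 < r * half by rewrite mulr_gt0.
  have [y [e [yx e0 ya]]] := far k x _ rh.
  have eh : 0 < e * half by rewrite mulr_gt0.
  have [d [d0 dr de]] := pos_lower_bound rh eh.
  exists (y, d); split; split => //=.
  + by rewrite (le_trans dr) // exprSr ler_pM2r.
  + rewrite (seminormBC sp) (le_trans (ltW yx)) // lerBrDr.
    by rewrite -[leRHS]halfD lerD2l.
  + move=> a /ya nlt le; apply: nlt; rewrite (le_lt_trans le) //.
    by rewrite (le_lt_trans de) // -[ltRHS]halfD ltrDl.
have [|e e0|k|x ux] :=
    complete_telescope sp (u := fst \o u) (r := snd \o u) cp.
- by move=> k; have [[/ltW]] := uP k.
- have [k ke] := exprn_lt_eps archK half01 e0; exists k.
  by have [[_ le _]] := uP k; rewrite (le_lt_trans le).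
- by have [_ []] := uP k.
(* The limit lies in every ball, so it avoids all q-balls of integer radius. *)
have [n xn] := archK (q x).
have [_ [_ /(_ x)]] := uP n; apply; last exact: ux.
by rewrite -(ger0_norm (seminorm_ge0 sq x)) ltW.
Qed.

(** Homogeneity moves the ball to the origin: approximants of [x0 + s *: x] and of [x0] are
    subtracted and rescaled by [s^-1], where [s = r / d] keeps [x0 + s *: x] in the ball. *)
Let dense_ball : exists2 C, 0 < C & forall d x, p x < d ->
  forall e, 0 < e -> exists a, q a <= C * d /\ p (x - a) < e.
Proof.
have [n [x0 [r [r0 dense]]]] := dense_somewhere.
exists ((n%:R + n%:R + 1) / r).
  by rewrite divr_gt0 // ltr_wpDl // addr_ge0.
move=> d x xd e e0.
have d0 : 0 < d := le_lt_trans (seminorm_ge0 sp x) xd.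
pose s := r / d; have s0 : 0 < s by rewrite divr_gt0.
have [half0 _] := andP half01.
have es : 0 < e * s * half.
  by rewrite mulr_gt0 // mulr_gt0.
have [a [qa xa]] : exists a, q a <= n%:R /\ p (x0 + s *: x - a) < e * s * half.
  apply: dense => //; rewrite addrAC subrr add0r seminormZ // gtr0_norm //.
  by rewrite mulrAC ltr_pdivrMr // ltr_pM2l.
have [b [qb xb]] : exists b, q b <= n%:R /\ p (x0 - b) < e * s * half.
  by apply: dense => //; rewrite subrr seminorm0.
exists (s^-1 *: (a - b)); split.
  rewrite seminormZ // gtr0_norm ?invr_gt0 // invf_div mulrC.
  rewrite [leRHS]mulrAC -[leRHS]mulrA ler_pM2r ?divr_gt0 //.
  rewrite (le_trans (seminormB sq _ _)) // (le_trans (lerD qa qb)) //.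
  by rewrite lerDl.
have -> : x - s^-1 *: (a - b) = s^-1 *: ((x0 + s *: x - a) - (x0 - b)).
  have -> : x0 + s *: x - a - (x0 - b) = s *: x - (a - b).
    rewrite !opprB -[x0 + _ - a]addrA (addrC x0) (addrC b) addrA addrK.
    by rewrite -addrA [- a + b]addrC.
  by rewrite [in RHS]scalerBr scalerA mulVf ?gt_eqF // scale1r.
rewrite seminormZ // gtr0_norm ?invr_gt0 // ltr_pdivrMl // mulrC.
by rewrite (le_lt_trans (seminormB sp _ _)) // -[ltRHS]halfD ltrD.
Qed.

(** Successive approximation: subtracting approximants leaves remainders [u k] with
    [p (u k) < d / 2 ^ k]. They q-converge to a point of p-seminorm 0, since [p <= q]; [x] minus
    that point is the lift. *)
Lemma seminorm_open_mapping : exists2 C, 0 < C &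
  forall d x, p x < d -> exists y, p (x - y) = 0 /\ q y <= C * d.
Proof.
have [C C0 dense] := dense_ball; exists (C * 2) => [|d x xd].
  by rewrite mulr_gt0.
have d0 : 0 < d := le_lt_trans (seminorm_ge0 sp x) xd.
have [half0 _] := andP half01.
pose P k y := p y < d * half ^+ k.
pose Q k y z := q (y - z) <= C * (d * half ^+ k).
have [||u [u0 uP]] := @dependent_choice_nat _ P Q x.
- by rewrite /P expr0 mulr1.
- move=> k y yk; have [|a [qa pa]] := dense _ _ yk (d * half ^+ k.+1).
    by rewrite mulr_gt0 // exprn_gt0.
  by exists (y - a); split=> //; rewrite /Q subKr.
pose r k := C * 2 * d * half ^+ k.
have [k|e e0|k|y uy] := complete_telescope sq (u := u) (r := r) cq.
- by rewrite !mulr_ge0 // ?exprn_ge0 // ltW.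
- have [|k ke] := exprn_lt_eps archK half01 (e := e / (C * 2 * d)).
    by rewrite !divr_gt0 ?mulr_gt0.
  by exists k; rewrite /r -ltr_pdivlMl ?mulr_gt0 // mulrC.
- have [_ /le_trans] := uP k; apply.
  rewrite /r exprSr [X in _ - X]mulrA -[X in X - _]halfD addrK.
  rewrite [leRHS]mulrAC [C * 2 * d * _]mulrAC /half mulfK ?pnatr_eq0 //.
  by rewrite mulrA.
exists (x - y); split.
  rewrite subKr; apply: seminorm_eq0 => // e e0.
  have [|k ke] := exprn_lt_eps archK half01 (e := e / (C * 2 * d + d)).
    by rewrite divr_gt0 // addr_gt0 ?mulr_gt0.
  have [yk _] := uP k.
  rewrite -(subKr (u k) y) (le_lt_trans (seminormB sp _ _)) //.
  rewrite addrC (le_lt_trans (lerD (le_trans (pq _) (uy k)) (ltW yk))) //.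
  by rewrite -mulrDl mulrC -ltr_pdivlMr // addr_gt0 ?mulr_gt0.
by have := uy 0; rewrite /r u0 expr0 mulr1.
Qed.

End OpenMapping.

(* If T is continuous from q to p and preserves the kernel of p, it descends to
   the Banach space X / ker p, which is a quotient of X / ker q by the open
   mapping theorem; hence T is continuous for p alone. *)
Lemma seminorm_continuous_of_ker (K : numFieldType) (X : lmodType K)
    (p q : X -> K) (T : {linear X -> X}) :
  Num.archimedean_axiom K -> is_seminorm p -> is_seminorm q ->
  complete_seminorm p -> complete_seminorm q -> (forall x, p x <= q x) ->
  (forall x, p x = 0 -> p (T x) = 0) ->
  (exists2 e, 0 < e & forall x, q x < e -> p (T x) < 1) ->
  forall e, 0 < e -> exists2 d, 0 < d & forall x, p x < d -> p (T x) < e.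
Proof.
move=> archK sp sq cp cq pq kerT [r r0 Tr] e e0.
have [C C0 open] := seminorm_open_mapping archK sp sq cp cq pq.
have eCr0 : 0 < e * r / C / 2 by rewrite !divr_gt0 ?mulr_gt0.
exists (e * r / C / 2) => // x /open[y [xy qy]].
apply: le_lt_trans (_ : p (T y) < _).
  by apply: seminorm_ker_le => //; rewrite -linearB kerT.
(* As [q y <= e * r / 2 < e * r], rescaling puts [y] into the q-ball of radius [r]. *)
have : p (T (e^-1 *: y)) < 1.
  apply: Tr; rewrite seminormZ // gtr0_norm ?invr_gt0 // ltr_pdivrMl //.
  rewrite (le_lt_trans qy) // mulrCA mulrA divfK ?gt_eqF //.
  by rewrite gtr_pMr ?mulr_gt0 // invf_lt1 ?ltr1n.
by rewrite linearZ seminormZ // gtr0_norm ?invr_gt0 // ltr_pdivrMl // mulr1.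
Qed.

(** * Correcting a pseudo-orbit modulo the kernel of one seminorm *)

Section Correction.
Variables (K : numFieldType) (archK : Num.archimedean_axiom K).
Variables (X : lmodType K) (p : X -> K).
Hypotheses (sp : is_seminorm p) (cp : complete_seminorm p).

(* The exact correction is sum_(k >= 0) (T^k y_(j-1-k) - S^(k+1) z_(j+k)); its
   n-th partial sum D n satisfies the recurrence up to T^n y_(j-n) +
   S^n z_(j+n), and T is p-continuous, so any p-limit will do. *)
Lemma bounded_correction (T : {linear X -> X}) (S : X -> X) (y z : int -> X)
    (C t : K) :
  0 < C -> 0 < t < 1 ->
  (forall e, 0 < e -> exists2 d, 0 < d & forall x, p x < d -> p (T x) < e) ->
  (forall j n, T (iter n.+1 S (z j)) = iter n S (z j)) ->
  (forall j n, p (iter n T (y j)) <= C * t ^+ n) ->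
  (forall j n, p (iter n S (z j)) <= C * t ^+ n) ->
  exists d : int -> X, forall j,
    p (d j) <= C * 2 / (1 - t) /\ p (d (j + 1) - (T (d j) + (y j + z j))) = 0.
Proof.
move=> C0 t01 Tcont TS yT zS; have /andP[t0 t1] := t01.
have t1' : 0 < 1 - t by rewrite subr_gt0.
pose f n (j : int) := iter n T (y (j - n%:Z)).
pose g n (j : int) := iter n S (z (j + n%:Z)).
pose D n j := \sum_(k < n) (f k (j - 1) - g k.+1 (j - 1)).
have Df n j : T (f n (j - 1)) = f n.+1 j.
  by rewrite /f /= -addn1 PoszD opprD addrA addrAC.
have Dg n j : T (g n.+1 (j - 1)) = g n j.
  rewrite /g TS; congr (iter _ _ (z _)).
  by rewrite -addn1 PoszD addrCA subrK addrC.
(* By [Df] and [Dg], the difference [D n (j + 1) - T (D n j)] telescopes in [f k j + g k j]. *)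
have DS n j : D n (j + 1) = T (D n j) + (y j + z j) - (f n j + g n j).
  have fg0 : f 0 j + g 0 j = y j + z j.
    by congr (y _ + z _); [exact: subr0|exact: addr0].
  rewrite -fg0; apply/eqP; rewrite -addrA [eqbRHS]addrC -subr_eq; apply/eqP.
  rewrite -[RHS]opprB -(telescope_sumr (fun k => f k j + g k j) (leq0n n)).
  rewrite big_mkord /D linear_sum -sumrB addrK -sumrN.
  apply: eq_bigr => k _; rewrite linearB Df Dg !opprB opprD.
  by rewrite addrACA [- g _ _ + _]addrC.
(* The tail of the geometric series of the increment bounds [C * 2 * t ^+ n]. *)
pose r n := C * 2 / (1 - t) * t ^+ n.
have r0 n : 0 <= r n by rewrite !mulr_ge0 ?invr_ge0 ?exprn_ge0 // ltW.
have rlim e : 0 < e -> exists n, r n < e.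
  move=> e0.
  have [|n ne] := exprn_lt_eps archK t01 (e := e / (C * 2 / (1 - t))).
    by rewrite !divr_gt0 ?mulr_gt0.
  by exists n; rewrite /r -ltr_pdivlMl ?divr_gt0 ?mulr_gt0 // mulrC.
have /choice[d dP] j : exists x, forall n, p (D n j - x) <= r n.
  apply: complete_telescope => // n.
  rewrite /D big_ord_recr /= opprD addrA subrr add0r (seminormN sp).
  rewrite (le_trans (seminormB sp _ _)) //.
  rewrite (le_trans (lerD (yT _ _) (zS _ _))) //.
  have -> : r n - r n.+1 = C * 2 * t ^+ n.
    rewrite /r exprSr -mulrBr -{1}[t ^+ n]mulr1 -mulrBr mulrCA.
    by rewrite divfK ?gt_eqF // mulrC.
  rewrite -mulrDr -mulrA ler_pM2l // mulr_natl mulr2n lerD2l exprSr.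
  by rewrite ler_piMr ?exprn_ge0 // ltW.
exists d => j; split.
  rewrite -(seminormN sp) -sub0r; have := dP j 0.
  by rewrite /D big_ord0 /r expr0 mulr1.
apply: seminorm_eq0 => // e e0.
(* One quarter each for replacing [d] by [D n] at [j + 1], for doing so inside [T], and for [f n j]
   and [g n j]. *)
have e4 : 0 < e / 4 by rewrite divr_gt0.
have [c c0 Tc] := Tcont _ e4; have [m [m0 mc me]] := pos_lower_bound c0 e4.
have [n rn] := rlim m m0.
have rne : r n < e / 4 := lt_le_trans rn me.
have Ctr : C * t ^+ n <= r n.
  rewrite ler_pM2r ?exprn_gt0 // -mulrA ler_pMr // ler_pdivlMr // mul1r.
  by rewrite (@le_trans _ _ 1) ?ler1n // gerBl ltW.
have -> : e = e / 4 + (e / 4 + (e / 4 + e / 4)).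
  by rewrite -!mulrDl -mulr2n -mulrS -mulrS -[e *+ 4]mulr_natr mulfK ?pnatr_eq0.
rewrite (le_lt_trans (seminorm_triangle sp (D n (j + 1)) _ _)) // ltrD //.
  by rewrite (seminormBC sp) (le_lt_trans (dP _ _)).
rewrite DS addrAC (addrC (T (d j))) addrKA -linearB.
rewrite (le_lt_trans (seminormB sp _ _)) // ltrD //.
  by rewrite Tc // (le_lt_trans (dP _ _)) // (lt_le_trans rn).
rewrite (le_lt_trans (seminormD sp _ _)) // ltrD //.
  by rewrite (le_lt_trans (yT _ _)) // (le_lt_trans Ctr).
by rewrite (le_lt_trans (zS _ _)) // (le_lt_trans Ctr).
Qed.

(** Each gap is the defect of the last step plus the image under [T] of the previous gap, both in
    the kernel. *)
Lemma iter_ker_shadow (T : {linear X -> X}) (w : nat -> X) :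
  (forall x, p x = 0 -> p (T x) = 0) ->
  (forall j, p (w j.+1 - T (w j)) = 0) ->
  forall n, p (w n - iter n T (w 0)) = 0.
Proof.
move=> kerT wT; elim=> [|n IHn]; first by rewrite subrr seminorm0.
rewrite -(subrKA (T (w n))) seminorm_kerD //= -linearB.
exact: kerT.
Qed.

End Correction.

(** * Neighborhoods of 0 for a directed family *)

Section InducedTopology.
Variables (K : numFieldType) (X : tvsType K) (I : Type) (p : I -> X -> K).
Hypotheses (sp : forall a, is_seminorm (p a)) (dp : directed_seminorms p).
Hypothesis tp : induced_by_seminorms p.

Lemma nbhs0_seminorm_ball a (e : K) : 0 < e -> nbhs 0 [set x | p a x < e].
Proof.
move=> e0; apply/tp; exists [set a]; split; first exact: finite_set1.
by exists e => // y /(_ a erefl); rewrite subr0.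
Qed.

Lemma directed_finite_upper_bound (F : set I) a : finite_set F ->
  exists b, (forall x, p a x <= p b x) /\
    forall i, F i -> forall x, p i x <= p b x.
Proof.
move=> /finite_setP[n]; elim: n F => [|n IHn] F.
  by rewrite II0 card_eq0 => /eqP ->; exists a.
move=> /eq_cardSP[i Fi /IHn[b [ab Fb]]]; have [c bc] := dp b i.
exists c; split=> [x|j Fj x]; first by rewrite (le_trans (ab x)) ?(bc x).1.
have [->|ji] := pselect (j = i); first by have [] := bc x.
by rewrite (le_trans (Fb j _ x)) ?(bc x).1.
Qed.

(* The point a takes care of the empty subfamily. *)
Lemma nbhs0_seminormP a (V : set X) : nbhs 0 V ->
  exists b, (forall x, p a x <= p b x) /\
    exists2 e : K, 0 < e & forall x, p b x < e -> V x.
Proof.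
move=> /tp[F [finF [e e0 FV]]].
have [b [ab Fb]] := directed_finite_upper_bound a finF.
exists b; split=> //; exists e => // x bx; apply: FV => i Fi.
by rewrite subr0 (le_lt_trans (Fb _ Fi x)).
Qed.

Lemma continuous0_seminorm (f : X -> X) a (e : K) :
  continuous f -> f 0 = 0 -> 0 < e -> nbhs 0 [set x | p a (f x) < e].
Proof.
move=> cf f0 e0; have := cf 0; rewrite /continuous_at f0.
by move=> /(_ [set x | p a x < e]); apply; exact: nbhs0_seminorm_ball.
Qed.

End InducedTopology.

(** The orbit defect of [x + d] is the error of [d] in its recurrence driven by [Tx - x']. *)
Lemma correction_defect (V : zmodType) (x' d' Tx Td : V) :
  x' + d' - (Tx + Td) = d' - (Td + (Tx - x')).
Proof.
by rewrite !opprD opprK addrACA [LHS]addrC -addrA [x' - _]addrC.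
Qed.

(** * Corrections from a hyperbolic splitting *)

Section Hyperbolic.
Variables (K : numFieldType) (archK : Num.archimedean_axiom K).
Variables (X : tvsType K) (I : Type) (p : I -> X -> K).
Hypotheses (sp : forall a, is_seminorm (p a))
  (cp : forall a, complete_seminorm (p a)) (dp : directed_seminorms p)
  (tp : induced_by_seminorms p).

Lemma direct_sum_projections (M N : set X) : topological_direct_sum M N ->
  exists PM PN : X -> X, [/\ continuous PM /\ PM 0 = 0,
    continuous PN /\ PN 0 = 0,
    forall x, M (PM x) /\ N (PN x) & forall x, x = PM x + PN x].
Proof.
move=> [subM subN [_ [g [cg addK gK]]]].
have M0 : 0 \in M by case: subM.
have N0 : 0 \in N by case: subN.
have g0 : g 0 = (SigSub M0, SigSub N0).
  by rewrite -[RHS]addK /= addr0.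
exists (fun x => \val (g x).1), (fun x => \val (g x).2); split.
- split; last by rewrite g0.
  move=> x; apply: (continuous_comp (f := fun x => (g x).1)).
    by apply: continuous_comp; [exact: cg|exact: cvg_fst].
  exact: initial_continuous.
- split; last by rewrite g0.
  move=> x; apply: (continuous_comp (f := fun x => (g x).2)).
    by apply: continuous_comp; [exact: cg|exact: cvg_snd].
  exact: initial_continuous.
- by move=> x; split; apply/set_mem; exact: valP.
- by move=> x; rewrite -[LHS]gK.
Qed.

Lemma hyperbolic_pseudo_orbit (T : {linear X -> X}) a (e : K) :
  continuous T -> generalized_hyperbolic p T ->
  (forall x, p a x = 0 -> p a (T x) = 0) -> 0 < e ->
  exists2 U : set X, nbhs 0 U & forall r : int -> X, (forall j, U (r j)) ->
    exists d : int -> X, forall j,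
      p a (d j) < e /\ p a (d (j + 1) - (T (d j) + r j)) = 0.
Proof.
move=> cT [M [N [MN TM [NTN Tinj _ _] hyp]]] kerT e0.
have [PM [PN [[cPM PM0] [cPN PN0] Pin PE]]] := direct_sum_projections MN.
have [b [c [t [c0 t01 yM zN]]]] := hyp a.
have /andP[t0 t1] := t01.
have t1' : 0 < 1 - t by rewrite subr_gt0.
(* [C] makes the bound [C * 2 / (1 - t)] equal to [e / 2]; [h] turns [c * t ^+ n * h] into
   [C * t ^+ n]. *)
pose C := e / 2 * (1 - t) / 2; pose h := C / c.
have C0 : 0 < C by rewrite !(mulr_gt0, divr_gt0).
have h0 : 0 < h by rewrite divr_gt0.
exists ([set x | p b (PM x) < h] `&` [set x | p b (PN x) < h]).
  by apply: filterI; apply: continuous0_seminorm.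
move=> r rU.
pose S := inv_on N T.
have SN x : N x -> N (S x).
  move=> Nx; rewrite -(injpinv_image (fun=> 0) Tinj).
  by exists x => //; exact: NTN.
have TS x : N x -> T (S x) = x.
  by move=> /NTN /mem_set; exact: pinvK.
have iterS n x : N x -> N (iter n S x) by move=> Nx; elim: n => //= n /SN.
have Ch n : c * t ^+ n * h = C * t ^+ n.
  by rewrite /h mulrAC [c * _]mulrC divfK ?gt_eqF.
have Tcont : forall e, 0 < e ->
    exists2 d, 0 < d & forall x, p a x < d -> p a (T x) < e.
  have [q [aq [u u0 qu]]] := nbhs0_seminormP dp tp a
    (continuous0_seminorm tp a cT (linear0 T) ltr01).
  by apply: (seminorm_continuous_of_ker archK (sp a) (sp q)) => //; exists u.
have [j n|j n|j n|d dP] := bounded_correction archK (sp a) (@cp a)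
  (T := T) (S := S) (y := PM \o r) (z := PN \o r) C0 t01 Tcont.
- by rewrite /= TS //; apply: iterS; have [] := Pin (r j).
- have [My _] := Pin (r j); rewrite (le_trans (yM _ _ My)) // -Ch.
  by rewrite ler_pM2l ?mulr_gt0 ?exprn_gt0 // ltW //; have [] := rU j.
- have [_ Nz] := Pin (r j); rewrite (le_trans (zN _ _ Nz)) // -Ch.
  by rewrite ler_pM2l ?mulr_gt0 ?exprn_gt0 // ltW //; have [] := rU j.
exists d => j; have [dC dr] := dP j; split; last by rewrite [r j]PE.
rewrite (le_lt_trans dC) // /C !divfK ?gt_eqF //.
by rewrite mulfK ?gt_eqF // gtr_pMr // invf_lt1 ?ltr1n.
Qed.

End Hyperbolic.

(** * Two-sided and positive shadowing *)

Theorem theorem6 (R : realType) (K : numFieldType) (hK : real_or_complex R K)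
    (X : tvsType K) (hX : hausdorff_space X) (I : Type) (p : I -> X -> K)
    (p_seminorm : forall a, is_seminorm (p a))
    (p_complete : forall a, complete_seminorm (p a))
    (p_directed : directed_seminorms p)
    (p_topology : induced_by_seminorms p) :
  (forall T : {linear X -> X}, GL T -> generalized_hyperbolic p T ->
     (forall a, T @` seminorm_ker (p a) = seminorm_ker (p a)) ->
     shadowing T) /\
  (forall T : {linear X -> X}, continuous T -> generalized_hyperbolic p T ->
     (forall a, T @` seminorm_ker (p a) `<=` seminorm_ker (p a)) ->
     positive_shadowing T).
Proof.
have archK := real_or_complex_archimedean hK.
(* The first alternative covers an empty [I], where only the whole space is a neighborhood of 0. *)
have small V : nbhs 0 V -> V = setT \/
    exists a, exists2 e : K, 0 < e & forall x, p a x < e -> V x.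
  have [[a _]|noI] := pselect (exists a : I, True).
    move=> /(nbhs0_seminormP p_directed p_topology a)[b [_ ?]].
    by right; exists b.
  move=> /p_topology[F [_ [e _ FV]]]; left; apply/seteqP; split => // x _.
  by apply: FV => i; case: noI; exists i.
split=> T cT hypT kerT V /small[->|[a [e e0 aV]]].
- by exists setT => [|x _]; [exact: filterT|exists 0].
- have [cT' [S [_ TK SK]]] := cT.
  have kerTa x : p a x = 0 -> p a (T x) = 0.
    move=> x0; suff: seminorm_ker (p a) (T x) by [].
    by rewrite -kerT; exists x.
  have kerTV x : p a (T x) = 0 -> p a x = 0.
    move=> Tx0; have : (T @` seminorm_ker (p a)) (T x) by rewrite kerT.
    by move=> [y y0 /(can_inj TK) <-].
  have Tinv x : T (inv_on setT T x) = x.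
    by apply: pinvK; apply/mem_set; exists (S x).
  have [U U0 UP] := hyperbolic_pseudo_orbit archK p_seminorm p_complete
    p_directed p_topology cT' hypT kerTa e0.
  exists U => // x xU; have [d dP] := UP (fun j => T (x j) - x (j + 1)) xU.
  pose w j := x j + d j.
  have wT j : p a (w (j + 1) - T (w j)) = 0.
    by rewrite /w linearD correction_defect; case: (dP j).
  (* Modulo the kernel, [x j - iterz T j (w 0)] is [- d j]. *)
  exists (w 0) => j; apply: aV; have [dj _] := dP j.
  apply: le_lt_trans dj; rewrite -(seminormN (p_seminorm a) (d j)).
  apply: seminorm_ker_le => //; rewrite opprK addrAC -/(w j).
  case: j => n.
    apply: (iter_ker_shadow (p_seminorm a) (w := w \o Posz)) => // j.
    by rewrite /= -addn1 PoszD wT.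
  (* Backward in time, [T] reflects the kernel because it maps the kernel onto itself. [Negz n] is
     [-(n + 1)], so the induction starts at time -1. *)
  have back i v : p a (w (i + 1) - v) = 0 -> p a (w i - inv_on setT T v) = 0.
    move=> iv; apply: kerTV; rewrite linearB /= Tinv.
    by rewrite -(subrKA (w (i + 1))) seminorm_kerD // seminormBC.
  elim: n => [|n IHn]; apply: back; first by rewrite /= subrr seminorm0.
  suff -> : Negz n.+1 + 1 = Negz n by [].
  by rewrite !NegzE [n.+2%:Z]intS opprD addrAC addNr add0r.
- by exists setT => [|x _]; [exact: filterT|exists 0].
have kerTa x : p a x = 0 -> p a (T x) = 0.
  by move=> x0; apply: (kerT a); exists x.
have [U U0 UP] := hyperbolic_pseudo_orbit archK p_seminorm p_complete
  p_directed p_topology cT hypT kerTa e0.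
exists U => // x xU.
(* The errors are extended by 0, a point of [U], to negative times. *)
pose r j := if j is Posz n then T (x n) - x n.+1 else 0.
have [|d dP] := UP r; first by case=> [n|n]; [exact: xU|exact: nbhs_singleton].
pose w n := x n + d n.
exists (w 0) => n; apply: aV; have [dn _] := dP n.
apply: le_lt_trans dn; rewrite -(seminormN (p_seminorm a) (d n)).
apply: seminorm_ker_le => //; rewrite opprK addrAC -/(w n).
apply: (iter_ker_shadow (p_seminorm a)) => // j.
have [_ <-] := dP j.
by rewrite /w linearD correction_defect -PoszD addn1.
Qed.
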